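(* For any Borel probability measure $\mu$ on $\mathcal{X}$ with $\operatorname{conv}(\operatorname{supp}(\mu))\subset V$, the MMSE denoiser $\widehat D_\mu$ is Lipschitz continuous on $V$ with Lipschitz constant $L_{\widehat D_\mu}\le\frac{M^2}{\lambda_{\min}(\widetilde\Sigma)}$.
   Context: $\mathcal{X}\subset\mathbb{R}^n$ is compact and $M>0$ is an upper bound of $\|\mathbf{x}\|$ for $\mathbf{x}\in\mathcal{X}$. $\Sigma\in\mathbb{R}^{n\times n}$ is symmetric positive semidefinite, $V=\operatorname{ran}(\Sigma)$, $r=\operatorname{rank}(\Sigma)$, $\Pi$ is an $n\times r$ matrix whose columns form an orthonormal basis of $V$, and $\widetilde\Sigma=\Pi^\top\Sigma\Pi$ (positive definite), with smallest eigenvalue $\lambda_{\min}(\widetilde\Sigma)$. The MMSE denoiser $\widehat D_\mu:V\to V$ is $$\widehat D_\mu(\mathbf{z})=\frac{\int_{\mathcal{X}}\mathbf{x}\,\varphi(\mathbf{z}-\mathbf{x})\,d\mu(\mathbf{x})}{\int_{\mathcal{X}}\varphi(\mathbf{z}-\mathbf{x})\,d\mu(\mathbf{x})},\qquad \varphi(\mathbf{v})=\exp\big(-\tfrac12\mathbf{v}^\top\Pi\widetilde\Sigma^{-1}\Pi^\top\mathbf{v}\big).$$ *)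

(* Defs.v *)
From HB Require Import structures.
From mathcomp Require Export all_boot all_order all_algebra.
From mathcomp Require Export all_classical all_reals all_analysis.
Export Order.TTheory GRing.Theory Num.Theory.
Export numFieldNormedType.Exports.

Set Implicit Arguments.
Unset Strict Implicit.
Unset Printing Implicit Defensive.

Local Open Scope classical_set_scope.
Local Open Scope ring_scope.

(* The library norm on matrices is the sup norm, whence this Euclidean one. *)
Definition enorm (R : realType) (n : nat) (v : 'cV[R]_n) : R :=
  Num.sqrt ((v^T *m v) 0 0).

Definition lipschitz_with (R : realType) (n : nat) (L : R) (V : set 'cV[R]_n)
    (f : 'cV[R]_n -> 'cV[R]_n) : Prop :=
  forall z z', V z -> V z' -> enorm (f z - f z') <= L * enorm (z - z').

Definition sym_psd (R : realType) (n : nat) (S : 'M[R]_n) : Prop :=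
  S^T = S /\ forall x : 'cV[R]_n, 0 <= (x^T *m S *m x) 0 0.

Definition ran (R : realType) (m n : nat) (A : 'M[R]_(m, n)) : set 'cV[R]_m :=
  range (fun x : 'cV[R]_n => A *m x).

(* The entries of P^T *m P are the pairwise inner products of the columns. *)
Definition orthonormal_basis_of (R : realType) (n r : nat)
    (P : 'M[R]_(n, r)) (V : set 'cV[R]_n) : Prop :=
  P^T *m P = 1%:M /\ ran P = V.

(* For a nonempty (hence finite) set of eigenvalues the infimum is attained;
   it is 0 for a 0 x 0 matrix. *)
Definition lambda_min (R : realType) (n : nat) (A : 'M[R]_n) : R :=
  inf [set a | eigenvalue A a].

Definition borel (R : realType) (n : nat) :=
  g_sigma_algebraType (@open 'cV[R]_n).

Definition msupp (R : realType) (n : nat) (mu : probability (borel R n) R)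
    : set 'cV[R]_n :=
  [set x | forall U : set 'cV[R]_n, open U -> U x -> (0 < mu U)%E].

Definition conv_hull (R : realType) (n : nat) (A : set 'cV[R]_n)
    : set 'cV[R]_n :=
  smallest (@convex_set R 'cV[R]_n) A.

Definition Sigma_tilde (R : realType) (n r : nat) (Sigma : 'M[R]_n)
    (Pi : 'M[R]_(n, r)) : 'M[R]_r :=
  Pi^T *m Sigma *m Pi.

Definition gauss_kernel (R : realType) (n r : nat) (Sigma : 'M[R]_n)
    (Pi : 'M[R]_(n, r)) (v : 'cV[R]_n) : R :=
  expR (- (2^-1 *
    (v^T *m Pi *m invmx (Sigma_tilde Sigma Pi) *m Pi^T *m v) 0 0)).

(* The vector-valued integral in the numerator is taken coordinatewise. *)
Definition mmse_denoiser (R : realType) (n r : nat) (X : set 'cV[R]_n)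
    (Sigma : 'M[R]_n) (Pi : 'M[R]_(n, r)) (mu : probability (borel R n) R)
    (z : 'cV[R]_n) : 'cV[R]_n :=
  (\int[mu]_(x in X) gauss_kernel Sigma Pi (z - x))^-1 *:
  \col_i \int[mu]_(x in X) ((x : 'cV[R]_n) i 0 * gauss_kernel Sigma Pi (z - x)).

(* Main.v *)
Require Import Defs.
From mathcomp Require Import ring lra measurable_realfun.

(* Write phi (z + h - x) = c(z, h) phi (z - x) e^(g x) with g x = <Q h, x> and
   Q = Pi St^-1 Pi^T: moving z to z + h tilts the posterior law of x by e^g.
   The tilt changes the mean of a bounded f by Cov (f, e^g) / E e^g, which is at
   most sup|f| b e^(2b) when |g| <= b.  Cutting the segment from z to z + h into
   m steps replaces b by b / m, and m -> oo gives the Lipschitz bound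
   M^2 |Q h| without any differentiation under the integral.  Finally
   |Q h| <= |h| / lambda_min St on V, because the infimum of the Rayleigh
   quotient of a symmetric matrix is an eigenvalue. *)

Set Implicit Arguments.
Unset Strict Implicit.
Unset Printing Implicit Defensive.

Local Open Scope classical_set_scope.
Local Open Scope ring_scope.

(** At [S = 1%:M] this is the Euclidean inner product, so one calculus serves both inner products
    and quadratic forms. *)
Definition form (R : realType) (n : nat) (S : 'M[R]_n) (x y : 'cV[R]_n) : R :=
  (x^T *m S *m y) 0 0.

(** * Quadratic forms *)

Section Forms.
Context {R : realType} {n : nat}.
Implicit Types (S : 'M[R]_n) (x y z : 'cV[R]_n).

Lemma formE S x y : form S x y = \sum_i \sum_j x i 0 * S i j * y j 0.
Proof.
rewrite /form mxE exchange_big; apply: eq_bigr => j _.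
rewrite mxE mulr_suml; apply: eq_bigr => i _.
by rewrite mxE.
Qed.

Lemma formDl S x y z : form S (x + y) z = form S x z + form S y z.
Proof. by rewrite /form linearD !mulmxDl mxE. Qed.

Lemma formDr S x y z : form S x (y + z) = form S x y + form S x z.
Proof. by rewrite /form mulmxDr mxE. Qed.

Lemma formZl S a x y : form S (a *: x) y = a * form S x y.
Proof. by rewrite /form linearZ -!scalemxAl mxE. Qed.

Lemma formZr S a x y : form S x (a *: y) = a * form S x y.
Proof. by rewrite /form -scalemxAr mxE. Qed.

Lemma formNr S x y : form S x (- y) = - form S x y.
Proof. by rewrite -scaleN1r formZr mulN1r. Qed.

Lemma formC S x y : S^T = S -> form S x y = form S y x.
Proof.
move=> symS; transitivity ((x^T *m S *m y)^T 0 0); first by rewrite mxE.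
by rewrite !trmx_mul trmxK symS mulmxA.
Qed.

Lemma form_mull S x y : form 1%:M (S *m x) y = form S^T x y.
Proof. by rewrite /form mulmx1 trmx_mul. Qed.

Lemma form_mulr S x y : form 1%:M x (S *m y) = form S x y.
Proof. by rewrite /form mulmx1 mulmxA. Qed.

Lemma form1E x y : form 1%:M x y = \sum_i x i 0 * y i 0.
Proof. by rewrite /form mulmx1 mxE; apply: eq_bigr => i _; rewrite mxE. Qed.

Lemma form1C x y : form 1%:M x y = form 1%:M y x.
Proof. by apply: formC; rewrite trmx1. Qed.

Lemma form1_ge0 x : 0 <= form 1%:M x x.
Proof. by rewrite form1E sumr_ge0 // => i _; rewrite -expr2 sqr_ge0. Qed.

Lemma form1_eq0 x : form 1%:M x x = 0 -> x = 0.
Proof.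
rewrite form1E => /eqP; rewrite psumr_eq0; last first.
  by move=> i _; rewrite -expr2 sqr_ge0.
move=> /allP x0; apply/colP => i; rewrite mxE.
by have /= := x0 i (mem_index_enum _); rewrite mulf_eq0 orbb => /eqP.
Qed.

Lemma form1_gt0 x : x != 0 -> 0 < form 1%:M x x.
Proof.
move=> x0; rewrite lt_neqAle form1_ge0 andbT eq_sym.
by apply: contra x0 => /eqP/form1_eq0 ->.
Qed.

Lemma sym_psd1 : sym_psd (1%:M : 'M[R]_n).
Proof. by split; [exact: trmx1 | exact: form1_ge0]. Qed.

(** Discriminant argument: the form at [t *: x + s *: y] is nonnegative for all [t] and [s], which
    are then chosen according to whether [form S y y] vanishes. *)
Lemma psd_cauchy_schwarz S x y : sym_psd S ->
  form S x y ^+ 2 <= form S x x * form S y y.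
Proof.
move=> [symS psdS].
have quad t s : 0 <= t ^+ 2 * form S x x + 2 * (t * s) * form S x y
                     + s ^+ 2 * form S y y.
  have := psdS (t *: x + s *: y); rewrite -/(form S _ _).
  rewrite !(formDl, formDr, formZl, formZr) (formC y x symS) => h.
  apply: le_trans h _; rewrite le_eqVlt; apply/orP; left; apply/eqP; ring.
have y0 := psdS y; rewrite -/(form S _ _) in y0.
have x0 := psdS x; rewrite -/(form S _ _) in x0.
move: (form S x x) (form S x y) (form S y y) quad x0 y0 => a b c quad a0 c0.
have [c00|cn0] := eqVneq c 0.
  have [->|bn0] := eqVneq b 0; first by rewrite c00 expr0n mulr0.
  (* With [c = 0] and [b != 0] the quadratic is affine in [s]; this [s] gives it the value -1. *)
  have := quad 1 (- (a + 1) / (2 * b)); rewrite c00.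
  have -> : 1 ^+ 2 * a + 2 * (1 * (- (a + 1) / (2 * b))) * b
    + (- (a + 1) / (2 * b)) ^+ 2 * 0 = -1 by field.
  by rewrite oppr_ge0 ler10.
have cgt0 : 0 < c by rewrite lt_neqAle eq_sym cn0.
(* The choice [t = c], [s = - b] is the minimizer [s = - b / c] at [t = 1], cleared of its
   denominator. *)
rewrite -subr_ge0 -(pmulr_rge0 _ cgt0).
have -> : c * (a * c - b ^+ 2) =
    c ^+ 2 * a + 2 * (c * - b) * b + (- b) ^+ 2 * c.
  by ring.
exact: quad.
Qed.

(** Cauchy-Schwarz for [S] at [S *m y] and [y] bounds [|S y|^4] by zero. *)
Lemma psd_form_eq0 S y : sym_psd S -> form S y y = 0 -> S *m y = 0.
Proof.
move=> psdS y0; apply: form1_eq0; rewrite form_mulr.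
apply/eqP; rewrite -sqrf_eq0 eq_le sqr_ge0 andbT.
by have := psd_cauchy_schwarz (S *m y) y psdS; rewrite y0 mulr0.
Qed.

Lemma form_ub S : exists2 K, 0 < K & forall y, form S y y <= K * form 1%:M y y.
Proof.
(* The sum of absolute entries suffices because [|y_i| |y_j| <= |y|^2]; the added 1 keeps the
   constant positive even for [S = 0]. *)
exists (1 + \sum_i \sum_j `|S i j|).
  by rewrite ltr_pwDl // sumr_ge0 // => i _; rewrite sumr_ge0.
move=> y; rewrite mulrDl mul1r; apply: ler_wpDl; first exact: form1_ge0.
rewrite formE mulr_suml; apply: ler_sum => i _.
rewrite mulr_suml; apply: ler_sum => j _.
have sq k : y k 0 ^+ 2 <= form 1%:M y y.
  rewrite form1E (bigD1 k) //= -expr2 lerDl sumr_ge0 // => l _.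
  by rewrite -expr2 sqr_ge0.
rewrite (le_trans (ler_norm _)) // mulrAC mulrC normrM ler_wpM2l //.
rewrite normrM; have := sq i; have := sq j.
rewrite -(real_normK (num_real (y i 0))) -(real_normK (num_real (y j 0))).
by have := sqr_ge0 (`|y i 0| - `|y j 0|); nra.
Qed.

(* Cauchy-Schwarz for S at (S^-1 y, y): |y|^4 <= <S^-1 y, y> <S y, y>. *)
Lemma psd_unit_coercive S : sym_psd S -> S \in unitmx ->
  exists2 c, 0 < c & forall y, c * form 1%:M y y <= form S y y.
Proof.
move=> psdS uS; have [symS _] := psdS.
have [K K0 ubK] := form_ub (invmx S).
exists K^-1; rewrite ?invr_gt0 // => y; rewrite ler_pdivrMl //.
have [->|y0] := eqVneq y 0.
  by rewrite -(scale0r 0) !formZl !mul0r mulr0.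
have := psd_cauchy_schwarz (invmx S *m y) y psdS.
have e1 : form S (invmx S *m y) y = form 1%:M y y.
  by rewrite (formC _ _ symS) -form_mulr mulmxA mulmxV // mul1mx.
have e2 : form S (invmx S *m y) (invmx S *m y) = form (invmx S) y y.
  by rewrite -form_mulr mulmxA mulmxV // mul1mx form1C form_mulr.
rewrite e1 e2 => h; rewrite -(ler_pM2l (form1_gt0 y0)) -expr2.
apply: le_trans h _; rewrite mulrA ler_wpM2r //.
  by case: psdS => _; exact.
by rewrite mulrC.
Qed.

End Forms.

(* S - l is singular when l is the infimum of the Rayleigh quotient: otherwise
   it would be coercive, and l could be increased.  Hence l is an eigenvalue. *)
Lemma lambda_min_rayleigh (R : realType) (r : nat) (S : 'M[R]_r) :
  (0 < r)%N -> sym_psd S -> S \in unitmx ->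
  0 < lambda_min S /\
  forall y, lambda_min S * form 1%:M y y <= form S y y.
Proof.
move=> r0 psdS uS; have [symS _] := psdS.
have [c c0 coer] := psd_unit_coercive psdS uS.
pose E := [set form S y y | y in [set y | form 1%:M y y = 1]].
have E0 : E !=set0.
  exists (form S (delta_mx (Ordinal r0) 0) (delta_mx (Ordinal r0) 0)).
  exists (delta_mx (Ordinal r0) 0) => //=.
  rewrite form1E (bigD1 (Ordinal r0)) //= big1 ?mxE ?eqxx ?mulr1 ?addr0 //.
  by move=> i /negbTE ni; rewrite !mxE ni mul0r.
have lbE d : (forall y, d * form 1%:M y y <= form S y y) -> d <= inf E.
  move=> hd; apply: lb_le_inf => // _ [y /= y1 <-].
  by have := hd y; rewrite y1 mulr1.
have hlb : has_lbound E.
  by exists c => _ [y /= y1 <-]; have := coer y; rewrite y1 mulr1.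
set l := inf E in lbE *.
have l0 : 0 < l by apply: lt_le_trans (lbE c coer).
have lP y : l * form 1%:M y y <= form S y y.
  have [->|y0] := eqVneq y 0.
    by rewrite -(scale0r 0) !formZl !mul0r mulr0.
  have yy := form1_gt0 y0.
  have sq : Num.sqrt (form 1%:M y y) ^+ 2 = form 1%:M y y.
    by rewrite sqr_sqrtr // ltW.
  rewrite -ler_pdivlMr // ge_inf //.
  exists ((Num.sqrt (form 1%:M y y))^-1 *: y) => /=;
    rewrite formZl formZr mulrA.
    by rewrite -expr2 exprVn sq mulVf // gt_eqF.
  by rewrite -expr2 exprVn sq mulrC.
pose B := S - l%:M.
have formB y : form B y y = form S y y - l * form 1%:M y y.
  rewrite /form /B mulmxBr mulmxBl mul_mx_scalar -scalemxAl mulmx1.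
  by rewrite [LHS]mxE [X in _ + X]mxE [X in _ - X]mxE.
have psdB : sym_psd B.
  split; first by rewrite /B linearB /= symS tr_scalar_mx.
  by move=> y; rewrite -/(form B y y) formB subr_ge0.
have [v v0 vB] : exists2 v : 'rV[R]_r, v != 0 & v *m B = 0.
  apply/det0P; apply/negPn; rewrite -unitfE -unitmxE; apply/negP => uB.
  have [d d0 hd] := psd_unit_coercive psdB uB.
  have := lbE (l + d); rewrite gerDl leNgt d0 => /(_ _)/notF; apply => y.
  by rewrite mulrDl; have := hd y; rewrite formB lerBrDl.
have evl : eigenvalue S l.
  apply/eigenvalueP; exists v => //.
  by move: vB; rewrite mulmxBr mul_mx_scalar => /eqP; rewrite subr_eq0 => /eqP.
(* The Rayleigh quotient at an eigenvector is its eigenvalue, so [l] is the least eigenvalue. *)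
have lbev a : eigenvalue S a -> l <= a.
  move=> /eigenvalueP[w wS w0].
  have := lP w^T.
  rewrite /form trmxK wS mulmx1 -scalemxAl [leRHS]mxE ler_pM2r //.
  have := @form1_gt0 _ _ w^T; rewrite /form mulmx1 trmxK; apply.
  by apply: contra w0 => /eqP w0; rewrite -(trmxK w) w0 trmx0.
have -> : lambda_min S = l; last by [].
apply/eqP; rewrite eq_le; apply/andP; split.
  by apply: ge_inf => //; exists l => a /= /lbev.
by apply: lb_le_inf; [exists l | move=> a /= /lbev].
Qed.

(** * The Euclidean norm and its characterization by duality *)

Section EuclideanNorm.
Context {R : realType} {n : nat}.
Implicit Types (x y z : 'cV[R]_n).

Lemma enormE x : enorm x = Num.sqrt (form 1%:M x x).
Proof. by rewrite /enorm /form mulmx1. Qed.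

Lemma enorm_ge0 x : 0 <= enorm x. Proof. exact: sqrtr_ge0. Qed.

Lemma sqr_enorm x : enorm x ^+ 2 = form 1%:M x x.
Proof. by rewrite enormE sqr_sqrtr // form1_ge0. Qed.

Lemma enorm0 : enorm (0 : 'cV[R]_n) = 0.
Proof. by rewrite enormE -(scale0r 0) formZl mul0r sqrtr0. Qed.

Lemma norm_form1_le x y : `|form 1%:M x y| <= enorm x * enorm y.
Proof.
rewrite -ler_sqr ?nnegrE ?mulr_ge0 ?enorm_ge0 //.
rewrite real_normK ?num_real // exprMn !sqr_enorm.
exact: psd_cauchy_schwarz sym_psd1.
Qed.

(** Duality: take [x = y] and divide by [enorm y]. Norm bounds on vector-valued means thus reduce to
    bounds on scalar means. *)
Lemma enorm_le_form1 (K : R) y : 0 <= K ->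
  (forall x, form 1%:M x y <= K * enorm x) -> enorm y <= K.
Proof.
move=> K0 h; have [->|y0] := eqVneq y 0; first by rewrite enorm0.
have ey : 0 < enorm y by rewrite enormE sqrtr_gt0 form1_gt0.
by rewrite -(ler_pM2r ey) -expr2 sqr_enorm.
Qed.

Lemma enormD x y : enorm (x + y) <= enorm x + enorm y.
Proof.
apply: enorm_le_form1 => [|z]; first by rewrite addr_ge0 ?enorm_ge0.
rewrite formDr mulrDl [enorm x * _]mulrC [enorm y * _]mulrC lerD //;
  exact: le_trans (ler_norm _) (norm_form1_le _ _).
Qed.

Lemma enorm_sub_trans x y z (p q : R) :
  enorm (x - y) <= p -> enorm (y - z) <= q -> enorm (x - z) <= p + q.
Proof.
move=> xy yz; rewrite -(subrK y x) -addrA.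
exact: le_trans (enormD _ _) (lerD xy yz).
Qed.

End EuclideanNorm.

(** * Integrals over a compact set *)

Section CompactBorel.
Context {R : realType} {n : nat}.
Implicit Types (X : set 'cV[R]_n) (f g : 'cV[R]_n -> R)
  (mu : probability (borel R n) R).

Lemma continuous_mulfun f g : continuous f -> continuous g ->
  continuous (fun x => f x * g x).
Proof. by move=> cf cg x; apply: continuousM; [exact: cf | exact: cg]. Qed.

Lemma continuous_addfun f g : continuous f -> continuous g ->
  continuous (fun x => f x + g x).
Proof. by move=> cf cg x; apply: continuousD; [exact: cf | exact: cg]. Qed.

Lemma open_borel_measurable X : open X -> measurable (X : set (borel R n)).
Proof. by move=> oX; exact: sub_sigma_algebra. Qed.

Lemma compact_borel_measurable X :
  compact X -> measurable (X : set (borel R n)).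
Proof.
move=> cX; rewrite -(setCK X); apply: measurableC; apply: open_borel_measurable.
by apply: closed_openC; apply: compact_closed cX; exact: norm_hausdorff.
Qed.

Lemma continuous_borel_measurable X f : measurable (X : set (borel R n)) ->
  continuous f -> measurable_fun (X : set (borel R n)) f.
Proof.
move=> mX /continuousP cf; apply: (measurability _ (RGenOpens.measurableE R)).
move=> _ [_ [a [b ->] <-]]; apply: measurableI => //.
by apply: open_borel_measurable; apply: cf; exact: interval_open.
Qed.

Lemma continuous_compact_integrable mu X f : compact X -> continuous f ->
  mu.-integrable (X : set (borel R n)) (EFin \o f).
Proof.
move=> cX cf; have mX := compact_borel_measurable cX.
apply: measurable_bounded_integrable => //.
- by rewrite (le_lt_trans (probability_le1 mu mX)) ?ltry.
- exact: continuous_borel_measurable.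
- have := compact_bounded (continuous_compact (continuous_subspaceT cf) cX).
  rewrite /bounded_set /bounded_near; apply: filterS => M hM x Xx.
  by apply: hM; exists x.
Qed.

(** Each point off the support has an open null neighbourhood, and finitely many of these cover
    [X]. *)
Lemma compact_null mu X : compact X -> (forall x, X x -> ~ msupp mu x) ->
  mu.-negligible (X : set (borel R n)).
Proof.
move=> cX hX.
pose D := [set U : set 'cV[R]_n | open U /\ mu U = 0%E].
have : finite_subset_cover D id X.
  move: cX; rewrite compact_cover; apply; first by move=> U [].
  move=> x Xx.
  have /existsNP[U /not_implyP[oU /not_implyP[Ux /negP]]] := hX x Xx.
  by rewrite measure_gt0 negbK => /eqP U0; exists U.
move=> [D' D'D]; rewrite /cover bigcup_fset => XD'.
apply: (@negligibleS _ _ _ mu _ X XD'); rewrite big_seq.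
elim/big_ind: _ => [|A B|U UD'].
- exact: negligible_set0.
- exact: negligibleU.
- have := D'D U UD'; rewrite inE => -[oU U0].
  by apply/negligibleP => //; exact: open_borel_measurable.
Qed.

(** The part of [X] where [f] is nonzero is the union over [k] of the compact sets where
    [|f| >= 1 / (k + 1)]. Each of them misses the support, hence is null. *)
Lemma Rintegral_msupp_eq0 mu X f : compact X -> continuous f ->
  (forall x, msupp mu x -> f x = 0) ->
  \int[mu]_(x in (X : set (borel R n))) f x = 0.
Proof.
move=> cX cf f0; have mX := compact_borel_measurable cX.
rewrite /Rintegral (ae_eq_integral (fun=> 0%E)) ?integral0 //.
- by apply/measurable_EFinP; exact: continuous_borel_measurable.
- pose K k := X `&` [set x | k.+1%:R^-1 <= `|f x|].
  apply: (@negligibleS _ _ _ mu (\bigcup_k K k)); last first.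
    apply: negligible_bigcup => k; apply: compact_null.
      apply: compact_closedI => //.
      apply: (@closed_comp _ _ (fun x => `|f x|) [set y | k.+1%:R^-1 <= y]).
        move=> x _; apply: continuous_comp; first exact: cf.
        exact: norm_continuous.
      exact: closed_ge.
    move=> x [_ /= fx] /f0 fx0; move: fx; rewrite fx0 normr0.
    by rewrite leNgt invr_gt0 ltr0n.
  move=> x /= /not_implyP[Xx fx].
  have {}fx : 0 < `|f x| by rewrite normr_gt0; apply: contra_notN fx => /eqP ->.
  have [k hk] := ltr_add_invr fx; exists k => //; split => //=.
  by rewrite ltW // -[ltLHS]add0r.
Qed.

End CompactBorel.

(** * Means under positive weights and under their exponential tilts *)

Section TiltedMeans.
Context {R : realType} {n : nat} (mu : probability (borel R n) R)
  (X : set 'cV[R]_n) (X_compact : compact X) (mu_X : mu X = 1%E).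
Implicit Types (f g w : 'cV[R]_n -> R).

Local Notation E f := (\int[mu]_(x in (X : set (borel R n))) f x).

Let mX := compact_borel_measurable X_compact.

Let int f (cf : continuous f) := continuous_compact_integrable mu X_compact cf.

Local Ltac cont :=
  repeat first [assumption | exact: cst_continuous
    | apply: continuous_mulfun | apply: continuous_addfun].

Lemma Rintegral_cst_prob a : E (fun=> a) = a.
Proof. 
rewrite Rintegral_cst //.
apply: eq_trans (congr1 (fun y => a * fine y) mu_X) _.
by rewrite mulr1.
Qed.

Lemma Rintegral_lin a b f g : continuous f -> continuous g ->
  E (fun x => a * f x + b * g x) = a * E f + b * E g.
Proof.
move=> cf cg; rewrite RintegralD //; try by apply: int; cont.
by rewrite !RintegralZl //; exact: int.
Qed.

Lemma Rintegral_le f g : continuous f -> continuous g ->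
  (forall x, X x -> f x <= g x) -> E f <= E g.
Proof. by move=> cf cg fg; apply: le_Rintegral => //; exact: int. Qed.

(** [X] is nonempty because it has mass 1, so [f] attains a positive minimum on it, which bounds the
    mean from below. *)
Lemma Rintegral_gt0 f : continuous f -> (forall x, X x -> 0 < f x) -> 0 < E f.
Proof.
move=> cf f0; have X0 : X !=set0.
  apply/set0P/eqP => X0; move: mu_X.
  by rewrite X0 measure0 => /esym/eqP; rewrite onee_eq0.
have [c cX hc] := compact_EVT_min X0 X_compact (continuous_subspaceT cf).
rewrite inE in cX; apply: lt_le_trans (f0 c cX) _.
rewrite -[leLHS]Rintegral_cst_prob; apply: Rintegral_le => //.
  exact: cst_continuous.
by move=> x Xx; apply: hc; rewrite inE.
Qed.

Section Weighted.
Variables (w : 'cV[R]_n -> R) (w_cont : continuous w).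
Hypothesis w_gt0 : forall x, X x -> 0 < w x.

Let N0 : 0 < E w. Proof. exact: Rintegral_gt0. Qed.

(** This is the variance of [f] under the density [w / E w], multiplied by [E w ^+ 2] to avoid
    fractions. *)
Lemma weighted_variance_ge0 f : continuous f ->
  0 <= E w * E (fun x => f x * f x * w x) - E (fun x => f x * w x) ^+ 2.
Proof.
move=> cf; set N := E w; set m := E (fun x => f x * w x).
have : 0 <= E (fun x => (N * f x - m) ^+ 2 * w x).
  by apply: Rintegral_ge0 => x Xx; rewrite mulr_ge0 ?sqr_ge0 // ltW // w_gt0.
have -> : E (fun x => (N * f x - m) ^+ 2 * w x) =
    E (fun x => N ^+ 2 * (f x * f x * w x)
       + 1 * ((- (2 * N * m)) * (f x * w x) + m ^+ 2 * w x)).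
  by apply: eq_Rintegral => x _ /=; ring.
rewrite !Rintegral_lin; [|by cont..].
rewrite -/N -/m.
rewrite [X in 0 <= X -> _](_ : _ =
    N * (N * E (fun x => f x * f x * w x) - m ^+ 2)); last by ring.
by rewrite pmulr_rge0.
Qed.

(* Expand 0 <= Var (B f - A g). *)
Lemma weighted_covariance_le f g (A B : R) : continuous f -> continuous g ->
  0 < A -> 0 < B ->
  (forall x, X x -> `|f x| <= A) -> (forall x, X x -> `|g x| <= B) ->
  E w * E (fun x => f x * g x * w x)
    - E (fun x => f x * w x) * E (fun x => g x * w x) <= E w ^+ 2 * (A * B).
Proof.
move=> cf cg A0 B0 fA gB.
have := @weighted_variance_ge0 (fun x => B * f x + (- A) * g x).
have -> : E (fun x => (B * f x + - A * g x) * (B * f x + - A * g x) * w x) =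
   E (fun x => B ^+ 2 * (f x * f x * w x) + 1 *
     ((- (2 * A * B)) * (f x * g x * w x) + A ^+ 2 * (g x * g x * w x))).
  by apply: eq_Rintegral => x _ /=; ring.
have -> : E (fun x => (B * f x + - A * g x) * w x) =
   E (fun x => B * (f x * w x) + (- A) * (g x * w x)).
  by apply: eq_Rintegral => x _ /=; ring.
rewrite !Rintegral_lin; [|by cont..].
have cd : continuous (fun x => B * f x + - A * g x) by cont.
move=> /(_ cd).
have sq (h : 'cV[R]_n -> R) (C : R) :
    continuous h -> (forall x, X x -> `|h x| <= C) ->
    E (fun x => h x * h x * w x) <= C ^+ 2 * E w.
  move=> ch hC; rewrite -RintegralZl //; last exact: int.
  apply: Rintegral_le => [||x Xx]; try by cont.
  apply: ler_wpM2r; first by apply/ltW/w_gt0.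
  rewrite -expr2 -real_normK ?num_real //.
  by rewrite ler_sqr ?nnegrE // ?hC // (le_trans _ (hC x Xx)).
have := sq _ _ cf fA; have := sq _ _ cg gB; have := N0.
move: (E w) (E (fun x => f x * f x * w x)) => N F2.
move: (E (fun x => g x * g x * w x)) => G2.
move: (E (fun x => f x * w x)) (E (fun x => g x * w x)) => F G.
move: (E (fun x => f x * g x * w x)) => FG N1 hG hF h.
(* The covariance enters the variance of [B f - A g] with the factor [2 A B]. The second moments are
   replaced by their bounds in [h1] and [h2], and the squares of [B F] and [A G] are dropped, having
   the favourable sign. *)
have AB : 0 < 2 * (A * B) by rewrite !mulr_gt0.
rewrite -(ler_pM2l AB) -subr_ge0.
have h1 : 0 <= N * (B ^+ 2 * (A ^+ 2 * N - F2)).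
  by rewrite pmulr_rge0 // mulr_ge0 ?sqr_ge0 ?subr_ge0.
have h2 : 0 <= N * (A ^+ 2 * (B ^+ 2 * N - G2)).
  by rewrite pmulr_rge0 // mulr_ge0 ?sqr_ge0 ?subr_ge0.
have := sqr_ge0 (B * F); have := sqr_ge0 (A * G); nra.
Qed.

(** The difference is the covariance of [f] and [e^g - 1] divided by the mean of [e^g]. One factor
    [e^b] comes from [|e^g - 1| <= e^b - 1 <= b e^b], the other from [e^g >= e^(-b)] in the
    denominator. *)
Lemma tilted_mean_le f g (A b : R) : continuous f -> continuous g ->
  0 < A -> 0 < b ->
  (forall x, X x -> `|f x| <= A) -> (forall x, X x -> `|g x| <= b) ->
  E (fun x => f x * (expR (g x) * w x)) / E (fun x => expR (g x) * w x)
    - E (fun x => f x * w x) / E w <= A * (b * expR (2 * b)).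
Proof.
move=> cf cg A0 b0 fA gb.
have ce : continuous (fun x => expR (g x)).
  by move=> x; apply: continuous_comp; [exact: cg | exact: continuous_expR].
have ck : continuous (fun x => expR (g x) + -1).
  by apply: continuous_addfun => //; exact: cst_continuous.
have B0 : 0 < expR b - 1 by rewrite subr_gt0 expR_gt1.
(* The lower bound needs [1 - e^(-b) <= e^b - 1], the sum of [1 + b <= e^b] and
   [1 - b <= e^(-b)]. *)
have kB x : X x -> `|expR (g x) + -1| <= expR b - 1.
  move=> Xx; move: (gb x Xx); rewrite !ler_norml => /andP[gl gu].
  have e1 : expR (- b) <= expR (g x) by rewrite ler_expR.
  have e2 : expR (g x) <= expR b by rewrite ler_expR.
  have := expR_ge1Dx b; have := expR_ge1Dx (- b); lra.
have := weighted_covariance_le cf ck A0 B0 fA kB.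
(* Subtracting 1 from [e^g] leaves the covariance unchanged but makes the second factor small. *)
have -> : E (fun x => f x * (expR (g x) + -1) * w x) =
    E (fun x => 1 * (f x * (expR (g x) * w x)) + -1 * (f x * w x)).
  by apply: eq_Rintegral => x _ /=; ring.
have -> : E (fun x => (expR (g x) + -1) * w x) =
    E (fun x => 1 * (expR (g x) * w x) + -1 * w x).
  by apply: eq_Rintegral => x _ /=; ring.
rewrite !Rintegral_lin; [|by cont..].
have hP : expR (- b) * E w <= E (fun x => expR (g x) * w x).
  rewrite -RintegralZl //; last exact: int.
  apply: Rintegral_le => [||x Xx]; try by cont.
  apply: ler_wpM2r; [by apply/ltW/w_gt0 | rewrite ler_expR].
  by move: (gb x Xx); rewrite ler_norml => /andP[].
have N1 := N0; move: hP N1.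
move: (E w) (E (fun x => expR (g x) * w x)) => N P hP N1.
move: (E (fun x => f x * w x)) (E (fun x => f x * (expR (g x) * w x))) => F Q h.
have P0 : 0 < P by apply: lt_le_trans hP; rewrite mulr_gt0 ?expR_gt0.
have -> : Q / P - F / N = (N * Q - F * P) / (N * P) by field; rewrite !gt_eqF.
rewrite ler_pdivrMr ?mulr_gt0 //.
have e1 : expR b - 1 <= b * expR b.
  have := expR_ge1Dx (- b); rewrite expRN => e.
  have := ler_wpM2r (expR_ge0 b) e; rewrite mulVf ?gt_eqF ?expR_gt0 //; nra.
have e2 : N <= expR b * P by rewrite -ler_pdivrMl ?expR_gt0 // -expRN.
rewrite (_ : 2 * b = b + b); last by ring.
rewrite expRD.
apply: (@le_trans _ _ (N ^+ 2 * (A * (expR b - 1)))); first by move: h; lra.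
rewrite (_ : A * _ * _ = (N * A) * ((b * expR b) * (expR b * P))); last by ring.
rewrite (_ : _ * (A * _) = (N * A) * ((expR b - 1) * N)); last by ring.
have NA : 0 <= N * A by rewrite mulr_ge0 // ltW.
apply: ler_wpM2l => //; apply: ler_pM => //; exact: ltW.
Qed.

End Weighted.
End TiltedMeans.

(** * The denoiser *)

Section QuadraticContinuity.
Context {R : realType} {n : nat}.
Implicit Types (S : 'M[R]_n) (f : 'cV[R]_n -> R).

Lemma continuous_sumr I (s : seq I) (F : I -> 'cV[R]_n -> R) :
  (forall i, continuous (F i)) -> continuous (fun x => \sum_(i <- s) F i x).
Proof.
move=> cF; elim: s => [|i s IH].
  rewrite (_ : (fun _ => _) = fun=> 0); first exact: cst_continuous.
  by apply/funext => x; rewrite big_nil.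
rewrite (_ : (fun _ => _) = fun x => F i x + \sum_(j <- s) F j x).
  exact: continuous_addfun.
by apply/funext => x; rewrite big_cons.
Qed.

Lemma continuous_form1 (u : 'cV[R]_n) : continuous (form 1%:M u).
Proof.
rewrite (_ : form 1%:M u = fun x : 'cV[R]_n => \sum_i u i 0 * x i 0);
  last first.
  by apply/funext => x; rewrite form1E.
apply: continuous_sumr => i; apply: continuous_mulfun.
  exact: cst_continuous.
by move=> x; exact: coord_continuous.
Qed.

Lemma continuous_form_shift S (z : 'cV[R]_n) :
  continuous (fun x : 'cV[R]_n => form S (z - x) (z - x)).
Proof.
rewrite (_ : (fun _ => _) = fun x : 'cV[R]_n =>
  \sum_i \sum_j (z i 0 - x i 0) * S i j * (z j 0 - x j 0)); last first.
  apply/funext => x; rewrite formE; apply: eq_bigr => i _.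
  by apply: eq_bigr => j _; rewrite !mxE.
have cB k : continuous (fun x : 'cV[R]_n => z k 0 - x k 0).
  move=> x; apply: continuousB; first exact: cst_continuous.
  exact: coord_continuous.
apply: continuous_sumr => i; apply: continuous_sumr => j.
apply: continuous_mulfun => //; apply: continuous_mulfun => //.
exact: cst_continuous.
Qed.

End QuadraticContinuity.

(** * Shifts of the kernel and the Lipschitz estimate *)

Section Denoiser.
Context {R : realType} {n r : nat} (X : set 'cV[R]_n) (X_compact : compact X)
  (Sigma : 'M[R]_n) (Pi : 'M[R]_(n, r)) (Sigma_sym : Sigma^T = Sigma)
  (mu : probability (borel R n) R) (mu_X : mu X = 1%E).

Local Notation E f := (\int[mu]_(x in (X : set (borel R n))) f x).
Local Notation phi := (gauss_kernel Sigma Pi).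
Local Notation D := (mmse_denoiser X Sigma Pi mu).
(** The precision matrix on the ambient space; for [Pi] an orthonormal basis of [ran Sigma] it is
    the pseudo-inverse of [Sigma]. *)
Let Q : 'M[R]_n := Pi *m invmx (Sigma_tilde Sigma Pi) *m Pi^T.

Lemma tr_precision : Q^T = Q.
Proof.
by rewrite /Q /Sigma_tilde !(trmx_mul, trmx_inv, trmxK) Sigma_sym !mulmxA.
Qed.

Lemma gauss_kernelE v : phi v = expR (- (2^-1 * form Q v v)).
Proof. by rewrite /gauss_kernel /form /Q !mulmxA. Qed.

Lemma gauss_kernel_continuous z : continuous (fun x : 'cV[R]_n => phi (z - x)).
Proof.
rewrite (_ : (fun _ => _) =
    fun x : 'cV[R]_n => expR (- 2^-1 * form Q (z - x) (z - x))); last first.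
  by apply/funext => x; rewrite gauss_kernelE mulNr.
move=> x; apply: continuous_comp; last exact: continuous_expR.
apply: continuousM; first exact: cst_continuous.
exact: continuous_form_shift.
Qed.

Lemma gauss_kernel_gt0 v : 0 < phi v. Proof. exact: expR_gt0. Qed.

(** Expand the square, merging the cross terms by symmetry of [Q]. The first factor does not depend
    on [x], so it cancels in the denoiser. *)
Lemma gauss_kernel_shift z h x :
  phi (z + h - x) =
  expR (- (form Q h z + 2^-1 * form Q h h)) * (expR (form Q h x) * phi (z - x)).
Proof.
rewrite !gauss_kernelE -!expRD; congr expR.
rewrite (_ : z + h - x = (z - x) + h); last by rewrite addrAC.
rewrite formDl !(formDr _ _ (z - x) h) (formC (z - x) h tr_precision).
rewrite (formDr _ h z (- x)) formNr; lra.
Qed.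

Let cphi := gauss_kernel_continuous.

Let cfphi (f : 'cV[R]_n -> R) z :
  continuous f -> continuous (fun x : 'cV[R]_n => f x * phi (z - x)).
Proof. by move=> cf; apply: continuous_mulfun. Qed.

Lemma Rintegral_sum_lin (I : Type) (s : seq I) (a : I -> R)
    (F : I -> 'cV[R]_n -> R) :
  (forall i, continuous (F i)) ->
  E (fun x : 'cV[R]_n => \sum_(i <- s) a i * F i x) =
  \sum_(i <- s) a i * E (F i).
Proof.
move=> cF; elim: s => [|i s IH].
  rewrite big_nil -[RHS](Rintegral_cst_prob X_compact mu_X).
  by apply: eq_Rintegral => x _; rewrite big_nil.
rewrite big_cons -IH -[X in _ + X]mul1r -Rintegral_lin //; last first.
  apply: continuous_sumr => j; apply: continuous_mulfun => //.
  exact: cst_continuous.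
by apply: eq_Rintegral => x _; rewrite big_cons mul1r.
Qed.

(** Pairing with a fixed [u] turns the coordinatewise mean into one scalar mean, to which the
    tilting estimate applies. *)
Lemma form1_denoiser u z :
  form 1%:M u (D z) =
  E (fun x : 'cV[R]_n => form 1%:M u x * phi (z - x)) / E (fun x => phi (z - x)).
Proof.
rewrite /mmse_denoiser formZr mulrC; congr (_ / _).
transitivity (E (fun x : 'cV[R]_n => \sum_i u i 0 * (x i 0 * phi (z - x)))).
  rewrite Rintegral_sum_lin; last first.
    move=> i; apply: (cfphi (f := fun x : 'cV[R]_n => x i 0)) => x.
    exact: coord_continuous.
  by rewrite form1E; apply: eq_bigr => i _; rewrite mxE.
apply: eq_Rintegral => x _; rewrite form1E mulr_suml.
by apply: eq_bigr => i _; rewrite mulrA.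
Qed.

Lemma form1_denoiserB u z z' :
  form 1%:M u (D z - D z') =
  E (fun x : 'cV[R]_n => form 1%:M u x * phi (z - x)) /
    E (fun x : 'cV[R]_n => phi (z - x)) -
  E (fun x : 'cV[R]_n => form 1%:M u x * phi (z' - x)) /
    E (fun x : 'cV[R]_n => phi (z' - x)).
Proof.
by rewrite formDr formNr; congr (_ - _); exact: form1_denoiser.
Qed.

Section Step.
Variables (M : R) (M_gt0 : 0 < M) (X_bounded : forall x, X x -> enorm x <= M).

(** By duality it suffices to pair with [u]: apply [tilted_mean_le] to [f = <u, x>], bounded by
    [M |u|], and [g = <Q h, x>], bounded by [b]. *)
Lemma denoiser_step z h b : 0 < b ->
  (forall x, X x -> `|form Q h x| <= b) ->
  enorm (D (z + h) - D z) <= M * (b * expR (2 * b)).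
Proof.
move=> b0 hb; have K0 : 0 <= M * (b * expR (2 * b)).
  by rewrite !mulr_ge0 ?expR_ge0 ?ltW.
apply: enorm_le_form1 => // u; have [->|u0] := eqVneq u 0.
  by rewrite enorm0 mulr0 -(scale0r 0) formZl mul0r.
have eu : 0 < enorm u by rewrite enormE sqrtr_gt0 form1_gt0.
rewrite form1_denoiserB.
set c := expR (- (form Q h z + 2^-1 * form Q h h)).
have cg : continuous (fun x : 'cV[R]_n => expR (form Q h x)).
  move=> x; apply: continuous_comp; last exact: continuous_expR.
  rewrite (_ : form Q h = fun x => form 1%:M (Q^T *m h) x).
    exact: continuous_form1.
  by apply/funext => y; rewrite form_mull trmxK.
have cgphi : continuous (fun x : 'cV[R]_n => expR (form Q h x) * phi (z - x)).
  exact: cfphi.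
have -> : E (fun x : 'cV[R]_n => phi (z + h - x)) =
    c * E (fun x : 'cV[R]_n => expR (form Q h x) * phi (z - x)).
  rewrite -RintegralZl //; first last.
  - exact: continuous_compact_integrable.
  - exact: compact_borel_measurable.
  by apply: eq_Rintegral => x _; rewrite gauss_kernel_shift.
have -> : E (fun x : 'cV[R]_n => form 1%:M u x * phi (z + h - x)) =
    c * E (fun x : 'cV[R]_n => form 1%:M u x * (expR (form Q h x) * phi (z - x))).
  rewrite -RintegralZl //; first last.
  - apply: continuous_compact_integrable => //.
    by apply: continuous_mulfun => //; exact: continuous_form1.
  - exact: compact_borel_measurable.
  by apply: eq_Rintegral => x _; rewrite gauss_kernel_shift /c mulrCA.
(* The common factor [c] cancels between numerator and denominator. *)
rewrite invfM mulrACA divff ?gt_eqF ?expR_gt0 // mul1r.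
rewrite [leRHS]mulrAC.
apply: (tilted_mean_le X_compact mu_X) => //.
- by move=> x _; exact: gauss_kernel_gt0.
- exact: continuous_form1.
- rewrite (_ : form Q h = fun x => form 1%:M (Q^T *m h) x).
    exact: continuous_form1.
  by apply/funext => y; rewrite form_mull trmxK.
- by rewrite mulr_gt0.
- move=> x Xx; apply: le_trans (norm_form1_le _ _) _.
  by rewrite mulrC ler_wpM2r ?enorm_ge0 // X_bounded.
Qed.

Lemma denoiser_segment z h b : 0 < b ->
  (forall x, X x -> `|form Q h x| <= b) ->
  enorm (D (z + h) - D z) <= M * b.
Proof.
move=> b0 hb; set y := enorm _.
have y0 : 0 <= y by exact: enorm_ge0.
(* Cut [h] into [m + 1] equal steps, a nonzero number. Summing the step bounds gives [y <= M b e^t]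
   with [t = 2 b / (m + 1)]; then [1 - t <= e^(-t)] gives [y (1 - t) <= M b]. *)
have hm m : m.+1%:R * (y - M * b) <= 2 * b * y.
  have m0 : 0 < m.+1%:R :> R by rewrite ltr0n.
  pose t := 2 * (b / m.+1%:R).
  have tele k : enorm (D (z + k%:R *: (m.+1%:R^-1 *: h)) - D z)
      <= k%:R * (M * (b / m.+1%:R * expR t)).
    elim: k => [|k IH]; first by rewrite scale0r addr0 subrr enorm0 mul0r.
    rewrite -natr1 scalerDl scale1r addrA mulrDl mul1r.
    rewrite [leRHS]addrC; apply: enorm_sub_trans IH.
    apply: denoiser_step; first by rewrite divr_gt0.
    move=> x Xx; rewrite formZl normrM ger0_norm ?invr_ge0 // mulrC.
    by rewrite ler_wpM2r ?invr_ge0 // hb.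
  have := tele m.+1; rewrite scalerA divff ?gt_eqF // scale1r -/y => hy.
  have {}hy : y <= M * b * expR t.
    apply: le_trans hy _; rewrite le_eqVlt; apply/orP; left; apply/eqP.
    by field; rewrite gt_eqF.
  have {}hy : y * expR (- t) <= M * b by rewrite expRN ler_pdivrMr ?expR_gt0.
  have hy2 : y * (1 - t) <= M * b.
    by apply: le_trans hy; rewrite ler_wpM2l // expR_ge1Dx.
  have -> : 2 * b * y = m.+1%:R * (y * t).
    by rewrite /t; field; rewrite gt_eqF.
  rewrite ler_pM2l //; lra.
(* If [y] exceeded [M b], the left side of [hm] would grow without bound in [m], against its fixed
   right side. *)
rewrite leNgt; apply/negP => ylt.
have d0 : 0 < y - M * b by rewrite subr_gt0.
have q0 : 0 <= 2 * b * y / (y - M * b).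
  by rewrite divr_ge0 ?mulr_ge0 // ltW.
have := archi_boundP q0; rewrite ltNge => /negP; apply.
rewrite ler_pdivlMr //; apply: le_trans (hm (Num.bound (2 * b * y / (y - M * b)))).
by rewrite ler_wpM2r ?ler_nat // ltW.
Qed.

(** Cauchy-Schwarz allows [b = |Q h| M] in the segment bound; the extra [e / M] makes [b] positive
    even when [Q h = 0], at the cost of an arbitrary [e]. *)
Lemma denoiser_lipschitz z h : enorm (D (z + h) - D z) <= M ^+ 2 * enorm (Q *m h).
Proof.
apply/ler_addgt0Pr => e e0.
rewrite (_ : _ + e = M * (enorm (Q *m h) * M + e / M)); last first.
  by field; rewrite gt_eqF.
apply: denoiser_segment.
  by rewrite ltr_wpDl ?divr_gt0 // mulr_ge0 ?enorm_ge0 ?ltW.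
move=> x Xx; rewrite -{1}tr_precision -form_mull.
apply: le_trans (norm_form1_le _ _) _.
apply: ler_wpDr; first by rewrite divr_ge0 ?ltW.
by rewrite ler_wpM2l ?enorm_ge0 // X_bounded.
Qed.

End Step.
End Denoiser.

(** * The compressed covariance and the norm of its inverse *)

Section SigmaTilde.
Context {R : realType} {n r : nat} (Sigma : 'M[R]_n) (Pi : 'M[R]_(n, r))
  (Sigma_psd : sym_psd Sigma) (Pi_basis : orthonormal_basis_of Pi (ran Sigma)).

Local Notation St := (Sigma_tilde Sigma Pi).

Lemma form_Sigma_tilde x y : form St x y = form Sigma (Pi *m x) (Pi *m y).
Proof. by rewrite /form /Sigma_tilde trmx_mul !mulmxA. Qed.

Lemma Sigma_tilde_psd : sym_psd St.
Proof.
have [symS psdS] := Sigma_psd; split.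
  by rewrite /Sigma_tilde !trmx_mul trmxK symS mulmxA.
by move=> x; rewrite -/(form St x x) form_Sigma_tilde psdS.
Qed.

(** For [v] in the kernel, [Pi v] lies in both the kernel and the range of the symmetric [Sigma];
    these are orthogonal, so [Pi v = 0], and [v = 0] since [Pi] has orthonormal columns. *)
Lemma Sigma_tilde_unit : St \in unitmx.
Proof.
have [PP ranPi] := Pi_basis; have [symS _] := Sigma_psd.
rewrite unitmxE unitfE; apply/negP => /det0P[v v0 vS].
have SPv : Sigma *m (Pi *m v^T) = 0.
  apply: psd_form_eq0 => //; rewrite -form_Sigma_tilde.
  by rewrite /form trmxK vS mul0mx mxE.
have [x _ xPv] : ran Sigma (Pi *m v^T) by rewrite -ranPi; exists v^T.
have /form1_eq0 Pv0 : form 1%:M (Pi *m v^T) (Pi *m v^T) = 0.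
  by rewrite -{1}xPv form_mull symS -form_mulr SPv -(scale0r 0) formZr mul0r.
move/eqP: v0; apply; apply: trmx_inj.
by rewrite trmx0 -(mul1mx v^T) -PP -mulmxA Pv0 mulmx0.
Qed.

(** [Pi] is an isometry, so with [h = Pi k] and [y = St^-1 k] the claim follows from [lambda_min
    |y|^2 <= <St y, y> = <k, y> <= |k| |y|]. *)
Lemma enorm_precision_le (h : 'cV[R]_n) : (0 < r)%N -> ran Sigma h ->
  enorm (Pi *m invmx St *m Pi^T *m h) <= enorm h / lambda_min St.
Proof.
move=> r0 hV; have [PP ranPi] := Pi_basis.
have [l0 lP] := lambda_min_rayleigh r0 Sigma_tilde_psd Sigma_tilde_unit.
have isoPi k : enorm (Pi *m k) = enorm k.
  by rewrite /enorm trmx_mul -!mulmxA (mulmxA Pi^T) PP mul1mx.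
move: hV; rewrite -ranPi => -[k _ <-].
rewrite -!mulmxA (mulmxA Pi^T) PP mul1mx !isoPi ler_pdivlMr //.
set y := invmx St *m k.
have ky : k = St *m y by rewrite /y mulmxA mulmxV ?mul1mx // Sigma_tilde_unit.
have [->|y0] := eqVneq y 0; first by rewrite enorm0 mul0r enorm_ge0.
have ey : 0 < enorm y by rewrite enormE sqrtr_gt0 form1_gt0.
rewrite -(ler_pM2l ey) mulrA -expr2 sqr_enorm mulrC.
apply: le_trans (lP y) _; rewrite -form_mulr -ky.
exact: le_trans (ler_norm _) (norm_form1_le _ _).
Qed.

End SigmaTilde.

(** Let [P] project onto the orthogonal complement of [V]. The squared norm of [P d] is the pairing
    of [d] with a vector [u] orthogonal to [V], hence a mean of a function vanishing on the
    support. *)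
Lemma denoiser_ran (R : realType) (n r : nat) (X : set 'cV[R]_n)
    (X_compact : compact X) (Sigma : 'M[R]_n)
    (Pi : 'M[R]_(n, r)) (V : set 'cV[R]_n) (Pi_basis : orthonormal_basis_of Pi V)
    (mu : probability (borel R n) R) (mu_X : mu X = 1%E)
    (supp_mu : msupp mu `<=` V) (z : 'cV[R]_n) :
  V (mmse_denoiser X Sigma Pi mu z).
Proof.
have [PP ranPi] := Pi_basis; set d := mmse_denoiser _ _ _ _ _.
rewrite -ranPi; exists (Pi^T *m d) => //.
apply/eqP; rewrite eq_sym -subr_eq0; apply/eqP.
pose P := 1%:M - Pi *m Pi^T.
rewrite mulmxA -[X in X - _]mul1mx -mulmxBl -/P.
apply: form1_eq0; rewrite form_mulr -(trmxK P) -form_mull.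
set u := P^T *m _; rewrite /d form1_denoiser //.
have -> : \int[mu]_(x in (X : set (borel R n)))
    (form 1%:M u x * gauss_kernel Sigma Pi (z - x)) = 0; last by rewrite mul0r.
apply: Rintegral_msupp_eq0 => //.
  apply: continuous_mulfun; first exact: continuous_form1.
  exact: gauss_kernel_continuous.
move=> x /supp_mu; rewrite -ranPi => -[k _ <-].
rewrite /u form_mull trmxK -form_mulr.
have -> : P *m (Pi *m k) = 0.
  by rewrite mulmxBl mul1mx -(mulmxA Pi) (mulmxA Pi^T) PP mul1mx subrr.
by rewrite -(scale0r 0) formZr !mul0r.
Qed.

Theorem lemma4p3 (R : realType) (n r : nat)
    (X : set 'cV[R]_n) (X_compact : compact X)
    (M : R) (M_gt0 : 0 < M) (X_bounded : forall x, X x -> enorm x <= M)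
    (Sigma : 'M[R]_n) (Sigma_psd : sym_psd Sigma) (rank_Sigma : \rank Sigma = r)
    (Pi : 'M[R]_(n, r)) (Pi_basis : orthonormal_basis_of Pi (ran Sigma))
    (mu : probability (borel R n) R) (mu_X : mu X = 1%E)
    (supp_mu : conv_hull (msupp mu) `<=` ran Sigma) :
  set_fun (ran Sigma) (ran Sigma) (mmse_denoiser X Sigma Pi mu) /\
  lipschitz_with (M ^+ 2 / lambda_min (Sigma_tilde Sigma Pi)) (ran Sigma)
    (mmse_denoiser X Sigma Pi mu).
Proof.
have Ssym := proj1 Sigma_psd; split.
  move=> z _; apply: denoiser_ran => //.
  exact: subset_trans (@sub_gen_smallest _ _ _) supp_mu.
move=> z z' [a _ za] [a' _ za'].
have hV : ran Sigma (z - z') by exists (a - a') => //; rewrite mulmxBr za za'.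
(* For [r = 0] the constant contains the default value [lambda_min = 0], so this case is separate:
   the range is the zero space and [z = z']. *)
have [r0|] := ltnP 0 r; last first.
  rewrite leqn0 => /eqP r0; suff -> : z = z' by rewrite !subrr enorm0 mulr0.
  apply/eqP; rewrite -subr_eq0; move: hV; rewrite -(proj2 Pi_basis) => -[k _ <-].
  by move: Pi k {rank_Sigma Pi_basis}; rewrite r0 => P k; rewrite thinmx0 mul0mx.
have [h zh] : exists h, z = z' + h by exists (z - z'); rewrite addrC subrK.
move: hV; rewrite zh (addrC z') addrK (addrC h) => hV.
apply: le_trans (denoiser_lipschitz X_compact Pi Ssym mu_X M_gt0 X_bounded _ _) _.
rewrite -mulrA ler_wpM2l ?sqr_ge0 // mulrC.
exact: enorm_precision_le.
Qed.
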